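(* Let $k$ be a field and let $f=Y^2+c(X)Y+p(X)\in k[X,Y]$, where $p(X)\in k[X]$ is a polynomial of odd degree and $c(X)\in k[X]$ has degree at most one. Assume that either $c(X)$ is a constant or $p(X)$ has degree at least three. Then $R=k[X,Y]/(f)$ is a unit-additive integral domain. However, if $\deg p\ge 3$ and $p$ has a root in $k$, then $R$ is not a principal ideal domain.
   Context: All rings are commutative and unital. A ring $R$ is unit-additive if whenever $u,v$ are units of $R$, $u+v$ is either a unit of $R$ or a nilpotent element. The constant $c(X)=0$ is allowed. *)

(* Defs.v *)
From mathcomp Require Import all_boot all_order all_algebra.

Set Implicit Arguments.
Unset Strict Implicit.
Unset Printing Implicit Defensive.

Import GRing.Theory.
Local Open Scope ring_scope.

Section RingNotions.
Variable R : comPzRingType.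

(* GRing.unit is only available on unitRingType, and {poly %/ h} has that
   structure only when its coefficients form a field. *)
Definition is_unit (u : R) : Prop := exists v : R, u * v = 1.

Definition is_nilpotent (x : R) : Prop := exists n : nat, x ^+ n = 0.

Definition unit_additive : Prop :=
  forall u v : R,
    is_unit u -> is_unit v -> is_unit (u + v) \/ is_nilpotent (u + v).

Definition is_integral_domain : Prop :=
  (1 : R) <> 0 /\ forall x y : R, x * y = 0 -> x = 0 \/ y = 0.

(* The idealr structure only covers proper ideals with decidable membership,
   hence this Prop-valued notion. *)
Definition is_ideal (I : R -> Prop) : Prop :=
  [/\ I 0, (forall x y, I x -> I y -> I (x + y))
         & (forall r x, I x -> I (r * x))].

Definition is_principal (I : R -> Prop) : Prop :=
  exists a : R, forall x : R, I x <-> exists r : R, x = r * a.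

Definition is_PID : Prop :=
  is_integral_domain /\ forall I : R -> Prop, is_ideal I -> is_principal I.

End RingNotions.

Arguments unit_additive R : clear implicits.
Arguments is_integral_domain R : clear implicits.
Arguments is_PID R : clear implicits.

(* k[X,Y] is {poly {poly k}} = k[X][Y]: the inner indeterminate is X and the
   outer one, written 'X below, is Y. *)
Definition curve_poly (k : fieldType) (c p : {poly k}) : {poly {poly k}} :=
  'X^2 + c%:P * 'X + p%:P.

Definition curve_ring (k : fieldType) (c p : {poly k}) : comNzRingType :=
  {poly %/ curve_poly c p}.

Section CurveRing.
Variables (k : fieldType) (c p : {poly k}).
Local Notation f := (curve_poly c p).

Lemma size_curve_poly : size f = 3.
Proof.
rewrite /curve_poly -addrA size_polyDl size_polyXn //.
rewrite (leq_ltn_trans (size_polyD _ _)) // gtn_max.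
rewrite (leq_ltn_trans (size_polyMleq _ _)) ?(leq_ltn_trans (size_polyC_leq1 _)) //.
by rewrite size_polyX addn2 /= ltnS ltnS size_polyC_leq1.
Qed.

Lemma monic_curve_poly : f \is monic.
Proof.
rewrite monicE /lead_coef size_curve_poly /curve_poly.
by rewrite !coefD coefXn coefCM coefX coefC /= mulr0 !addr0.
Qed.

(* {poly %/ h} falls back to 'X when h is not monic of positive degree; the
   following facts show that this does not happen here and that curve_ring is
   the quotient of k[X,Y] by (f). *)
Lemma mk_monic_curve_poly : mk_monic f = f.
Proof. by rewrite /mk_monic size_curve_poly monic_curve_poly. Qed.

Lemma in_curve_ring_surj (x : curve_ring c p) : exists q, in_qpoly f q = x.
Proof.
by exists (x : {poly %/ f}); apply/val_inj/in_qpoly_small/size_mk_monic.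
Qed.

Lemma in_curve_ring_eq0 (q : {poly {poly k}}) :
  in_qpoly f q = 0 <-> exists r, q = r * f.
Proof.
split=> [/(congr1 val) /= | [r ->]]; last first.
  by apply: val_inj; rewrite /= mk_monic_curve_poly
    Pdiv.RingMonic.rmodp_mull ?monic_curve_poly.
rewrite mk_monic_curve_poly => q0; exists (Pdiv.CommonRing.rdivp q f).
by rewrite {1}(Pdiv.RingMonic.rdivp_eq monic_curve_poly q) q0 addr0.
Qed.

End CurveRing.

(* Main.v *)
Require Import Defs.
From mathcomp Require Import all_boot all_order all_algebra.
From mathcomp Require Import ring zify.

(** Every element of [R] is uniquely [g + hY] with [g, h] in [k[X]], and its norm
    over [k[X]] is [g^2 - c g h + p h^2].  Since [deg p] is odd, [g^2] and
    [p h^2] have distinct degrees, and the bound on [deg c] makes the cross term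
    smaller than the larger of the two; so the norm has degree
    [max (2 deg g) (deg p + 2 deg h)].  Hence the norm vanishes only at [0], and
    the units of [R] are the nonzero constants.  If [p(a) = 0] and
    [deg p >= 3], a generator [z] of the ideal [(X - a, Y)] has norm dividing
    [(X - a)^2], so [z] lies in [k[X]]; as [z] divides [Y], it is a constant,
    whereas the ideal is proper. *)

Import GRing.Theory.
Local Open Scope ring_scope.

(** This is the product of g + hY and its conjugate g - h(c + Y), where Y and -c - Y are the two
    roots of f over k[X]. *)
Definition curve_norm {k : fieldType} (c p g h : {poly k}) : {poly k} :=
  g ^+ 2 - c * g * h + p * h ^+ 2.

(** * The basis 1, Y of R over k[X] *)

Section Coordinates.
Variables (k : fieldType) (c p : {poly k}).

Definition curve_mk (g h : {poly k}) : curve_ring c p :=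
  in_qpoly (curve_poly c p) (g%:P + h%:P * 'X).

Definition coordc (x : curve_ring c p) : {poly k} :=
  (x : {poly %/ curve_poly c p})`_0.
Definition coordY (x : curve_ring c p) : {poly k} :=
  (x : {poly %/ curve_poly c p})`_1.

Lemma size_linear_poly (g h : {poly k}) : (size (g%:P + h%:P * 'X)%R < 3)%N.
Proof.
rewrite ltnS (leq_trans (size_polyD _ _)) // geq_max.
rewrite (leq_trans (size_polyC_leq1 _)) //=.
by rewrite (leq_trans (size_polyMleq _ _)) // size_polyX addn2 ltnS size_polyC_leq1.
Qed.

Lemma curve_mk_val (g h : {poly k}) :
  (curve_mk g h : {poly %/ curve_poly c p}) = g%:P + h%:P * 'X :> {poly {poly k}}.
Proof.
rewrite /curve_mk /= mk_monic_curve_poly Pdiv.CommonRing.rmodp_small //.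
by rewrite size_curve_poly size_linear_poly.
Qed.

Lemma coordc_mk (g h : {poly k}) : coordc (curve_mk g h) = g.
Proof. by rewrite /coordc curve_mk_val coefD coefC coefMX /= addr0. Qed.

Lemma coordY_mk (g h : {poly k}) : coordY (curve_mk g h) = h.
Proof. by rewrite /coordY curve_mk_val coefD coefC coefMX coefC /= add0r. Qed.

Lemma curve_mk_coord (x : curve_ring c p) : curve_mk (coordc x) (coordY x) = x.
Proof.
apply: val_inj; rewrite [LHS]curve_mk_val /=; apply/polyP => i.
rewrite coefD coefC coefMX coefC.
case: i => [|[|i]] /=; rewrite ?addr0 ?add0r //.
rewrite [RHS]nth_default // -ltnS.
rewrite (leq_trans (size_mk_monic (x : {poly %/ curve_poly c p}))) //.
by rewrite mk_monic_curve_poly size_curve_poly.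
Qed.

Lemma curve_mkD (g h g' h' : {poly k}) :
  curve_mk g h + curve_mk g' h' = curve_mk (g + g') (h + h').
Proof. by rewrite /curve_mk -in_qpolyD !polyCD; congr in_qpoly; ring. Qed.

Lemma curve_mkM (g h g' h' : {poly k}) :
  curve_mk g h * curve_mk g' h' =
  curve_mk (g * g' - p * (h * h')) (g * h' + h * g' - c * (h * h')).
Proof.
rewrite /curve_mk -in_qpolyM.
(* The product has Y^2-coefficient h h'. Adding h h' f, which is zero in R, to the right-hand side
   leaves an identity in k[X][Y]. *)
have /in_curve_ring_eq0 f0 :
    exists r, (h * h')%:P * curve_poly c p = r * curve_poly c p.
  by exists (h * h')%:P.
rewrite -[RHS]addr0 -f0 -in_qpolyD; congr in_qpoly.
by rewrite /curve_poly !(polyCD, polyCN, polyCM); ring.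
Qed.

Lemma curve_mk0 : curve_mk 0 0 = 0.
Proof. by apply: val_inj; rewrite [LHS]curve_mk_val mul0r addr0. Qed.

Lemma curve_mk1 : curve_mk 1 0 = 1.
Proof.
by apply: val_inj; rewrite [LHS]curve_mk_val mul0r addr0.
Qed.

End Coordinates.

Arguments curve_mk {k}.
Arguments coordc {k c p}.
Arguments coordY {k c p}.
Arguments curve_mk_coord {k c p}.
Arguments curve_mk0 {k}.
Arguments curve_mk1 {k}.

(** * Degrees of norms and their consequences *)

Section Norm.
Variables (k : fieldType) (c p : {poly k}).
Hypothesis odd_deg_p : odd (size p).-1.
Hypothesis deg_c : ((size c).-1 <= 1)%N.
Hypothesis c_const_or_deg_p : (exists a : k, c = a%:P) \/ (3 <= (size p).-1)%N.

Lemma size_curve_norm (g h : {poly k}) :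
  size (curve_norm c p g h) = maxn (size (g ^+ 2)) (size (p * h ^+ 2)).
Proof.
have p0 : p != 0 by apply: contraTneq odd_deg_p => ->; rewrite size_poly0.
rewrite /curve_norm; have [->|g0] := eqVneq g 0.
  by rewrite expr0n mulr0 mul0r subr0 add0r size_poly0 max0n.
have [->|h0] := eqVneq h 0.
  by rewrite expr0n !mulr0 subr0 addr0 size_poly0 maxn0.
have sg : (0 < size g)%N by rewrite size_poly_gt0.
have sh : (0 < size h)%N by rewrite size_poly_gt0.
have sp : (0 < size p)%N by rewrite size_poly_gt0.
have sg2 : size (g ^+ 2) = (2 * size g).-1 by rewrite expr2 size_mul // mul2n addnn.
have sph : size (p * h ^+ 2) = (size p + (2 * size h).-1).-1.
  by rewrite size_mul ?expf_neq0 // expr2 size_mul // mul2n addnn.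
have size_c : (size c <= 1)%N \/ (3 <= (size p).-1)%N.
  by case: c_const_or_deg_p => [[a ->]|]; [left; exact: size_polyC_leq1|right].
(* The hypotheses give 2 deg c < deg p when c is nonzero, so deg(cgh) lies strictly below the
   average of 2 deg g and deg p + 2 deg h, hence below the larger one. *)
have : (size (- (c * g * h))%R < size (g ^+ 2)%R)%N ||
       (size (- (c * g * h))%R < size (p * h ^+ 2)%R)%N.
  rewrite size_polyN sg2 sph; have [->|c0] := eqVneq c 0.
    by rewrite !mul0r size_poly0; move: (size g) sg; lia.
  rewrite size_mul ?mulf_neq0 // size_mul //.
  move: odd_deg_p deg_c size_c sg sh sp.
  by move: (size c) (size g) (size h) (size p); lia.
have : size (g ^+ 2) != size (p * h ^+ 2).
  rewrite sg2 sph; move: odd_deg_p sg sh sp.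
  by move: (size g) (size h) (size p); lia.
rewrite addrAC neq_ltn => /orP[] lt scgh.
  rewrite (addrC (g ^+ 2)) (maxn_idPr (ltnW lt)) -addrA size_polyDl //.
  rewrite (leq_ltn_trans (size_polyD _ _)) // gtn_max lt.
  by case/orP: scgh => // /ltn_trans->.
rewrite (maxn_idPl (ltnW lt)) -addrA size_polyDl //.
rewrite (leq_ltn_trans (size_polyD _ _)) // gtn_max lt.
by case/orP: scgh => // /ltn_trans->.
Qed.

Lemma curve_norm_eq0 (g h : {poly k}) :
  curve_norm c p g h = 0 -> g = 0 /\ h = 0.
Proof.
move=> /(congr1 (fun q : {poly k} => size q)); rewrite size_curve_norm size_poly0.
move=> /eqP; rewrite -leqn0 geq_max !size_poly_leq0 expf_eq0 mulf_eq0 expf_eq0 /=.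
have -> : (p == 0) = false.
  by apply: contraTF odd_deg_p => /eqP->; rewrite size_poly0.
by move=> /andP[/eqP-> /eqP->].
Qed.

(** A nonzero h would contribute p h^2, of degree at least deg p, and this term cannot cancel. The
    lemma puts both units and the supposed generator into k[X]. *)
Lemma coordY_eq0_of_small_norm (g h : {poly k}) :
  (size (curve_norm c p g h) < size p)%N -> h = 0.
Proof.
rewrite size_curve_norm gtn_max => /andP[_]; apply: contraTeq => h0.
have p0 : p != 0 by apply: contraTneq odd_deg_p => ->; rewrite size_poly0.
rewrite -leqNgt size_mul ?expf_neq0 //.
have : (0 < size (h ^+ 2)%R)%N by rewrite size_poly_gt0 expf_neq0.
by move: (size p) (size (h ^+ 2)%R); lia.
Qed.

(** Multiplicativity of the norm: the arguments on the left are the coordinates of the product given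
    by [curve_mkM]. *)
Lemma curve_normM (g h g' h' : {poly k}) :
  curve_norm c p (g * g' - p * (h * h')) (g * h' + h * g' - c * (h * h')) =
  curve_norm c p g h * curve_norm c p g' h'.
Proof. by rewrite /curve_norm; ring. Qed.

Lemma curve_ring_domain : is_integral_domain (curve_ring c p).
Proof.
split=> [|x y]; first by apply/eqP; exact: oner_neq0.
rewrite -(curve_mk_coord x) -(curve_mk_coord y).
move: (coordc x) (coordY x) (coordc y) (coordY y) => g h g' h'.
rewrite curve_mkM => xy0.
have eqc := congr1 coordc xy0; have eqY := congr1 coordY xy0.
(* The norm of xy is 0, so one of the two norms vanishes in the domain k[X]. *)
have := curve_normM g h g' h'.
rewrite -(curve_mk0 c p) !coordc_mk !coordY_mk in eqc eqY.
rewrite eqc eqY {1}/curve_norm expr0n !mulr0 subr0 addr0 => /esym/eqP.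
rewrite mulf_eq0 => /orP[] /eqP/curve_norm_eq0[-> ->]; rewrite curve_mk0.
  by left.
by right.
Qed.

Lemma curve_ring_unitP (u : curve_ring c p) :
  is_unit u <-> exists2 a : k, a != 0 & u = curve_mk c p a%:P 0.
Proof.
split=> [[v]|[a a0 ->]]; last first.
  exists (curve_mk c p (a^-1)%:P 0); rewrite curve_mkM -polyCM mulfV //.
  by rewrite !mul0r !mulr0 !subr0 addr0 curve_mk1.
rewrite -(curve_mk_coord u) -(curve_mk_coord v).
move: (coordc u) (coordY u) (coordc v) (coordY v) => g h g' h'.
rewrite curve_mkM => uv1.
have eqc := congr1 coordc uv1; have eqY := congr1 coordY uv1.
rewrite -(curve_mk1 c p) !coordc_mk !coordY_mk in eqc eqY.
have := curve_normM g h g' h'.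
rewrite eqc eqY {1}/curve_norm expr0n !mulr0 subr0 addr0 expr1n => /esym N1.
have sN : size (curve_norm c p g h) == 1%N.
  move/(congr1 (fun q : {poly k} => size q))/eqP: N1.
  by rewrite size_poly1 size_mul_eq1 => /andP[].
(* An odd degree is at least 1, so [size p] exceeds the size 1 of the norm. *)
have h0 : h = 0.
  apply: (coordY_eq0_of_small_norm g); rewrite (eqP sN).
  by case: (size p) odd_deg_p => [|[]].
move: eqc; rewrite h0 mul0r mulr0 subr0.
move/(congr1 (fun q : {poly k} => size q))/eqP.
rewrite size_poly1 size_mul_eq1 => /andP[/size_poly1P[a a0 ->] _].
by exists a.
Qed.

(** The units together with 0 form the field k, which is closed under addition. *)
Lemma curve_ring_unit_additive : unit_additive (curve_ring c p).
Proof.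
move=> u v /curve_ring_unitP[a a0 ->] /curve_ring_unitP[b b0 ->].
rewrite curve_mkD -polyCD addr0.
have [->|ab0] := eqVneq (a + b) 0.
  by right; exists 1%N; rewrite curve_mk0 expr1.
by left; apply/curve_ring_unitP; exists (a + b).
Qed.

Lemma curve_ring_not_PID (a : k) :
  (3 <= (size p).-1)%N -> root p a -> ~ is_PID (curve_ring c p).
Proof.
move=> dp pa0 [_ PID].
(* This is the ideal (X - a, Y), the kernel of evaluation at (a, 0). That point lies on the curve
   because p(a) = 0, which gives closure under multiplication. *)
pose I (x : curve_ring c p) := (coordc x).[a] = 0.
have Imk g h : I (curve_mk c p g h) <-> g.[a] = 0 by rewrite /I coordc_mk.
have idI : is_ideal I.
  split=> [|x y|r x].
  - by rewrite -curve_mk0 Imk horner0.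
  - rewrite -{2}(curve_mk_coord x) -{2}(curve_mk_coord y) curve_mkD Imk hornerD.
    by move=> -> ->; rewrite addr0.
  - rewrite -(curve_mk_coord r) -{2}(curve_mk_coord x) curve_mkM Imk.
    by rewrite hornerD hornerN !hornerM (rootP pa0) => ->; rewrite mulr0 mul0r subr0.
have [z Iz] := PID I idI.
have {}Iz x : I x <-> exists r, x = r * curve_mk c p (coordc z) (coordY z).
  by rewrite curve_mk_coord.
move: (coordc z) (coordY z) Iz => g h Iz.
have /Iz[r] : I (curve_mk c p ('X - a%:P) 0) by rewrite Imk hornerXsubC subrr.
have /Iz[s] : I (curve_mk c p 0 1) by rewrite Imk horner0.
have Ig : I (curve_mk c p g h).
  by apply/Iz; exists 1; rewrite mul1r.
rewrite -(curve_mk_coord s) -(curve_mk_coord r) !curve_mkM.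
move: (coordc r) (coordY r) (coordc s) (coordY s) => r0 r1 s0 s1 eqs eqr.
(* The norm of the generator divides that of X - a, namely (X - a)^2, whose degree 2 is below deg
   p. *)
have h0 : h = 0.
  apply: (coordY_eq0_of_small_norm g).
  have eqc := congr1 coordc eqr; have eqY := congr1 coordY eqr.
  rewrite !coordc_mk !coordY_mk in eqc eqY.
  have := curve_normM r0 r1 g h.
  rewrite -eqc -eqY {1}/curve_norm expr0n !mulr0 subr0 addr0 => eqN.
  have : (size (curve_norm c p g h) <= size (('X - a%:P) ^+ 2)%R)%N.
    apply: dvdp_leq; first by rewrite expf_neq0 // polyXsubC_eq0.
    by rewrite eqN dvdp_mulIr.
  by rewrite size_exp_XsubC; lia.
(* With h = 0, the Y-coordinate of Y = s z reads 1 = s1 g; evaluating at a, where g vanishes, gives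
   1 = 0. *)
have := congr1 coordY eqs.
rewrite !coordY_mk h0 mulr0 add0r mulr0 mulr0 subr0 => /(congr1 (horner^~ a)).
move/Imk: Ig => g_a; rewrite hornerC hornerM g_a mulr0 => /eqP.
by rewrite oner_eq0.
Qed.

End Norm.

Theorem theorem5p2 (k : fieldType) (c p : {poly k})
    (odd_deg_p : odd (size p).-1)
    (deg_c : ((size c).-1 <= 1)%N)
    (c_const_or_deg_p : (exists a : k, c = a%:P) \/ (3 <= (size p).-1)%N) :
  [/\ unit_additive (curve_ring c p),
      is_integral_domain (curve_ring c p)
    & (3 <= (size p).-1)%N -> (exists a : k, root p a) ->
      ~ is_PID (curve_ring c p)].
Proof.
split; [exact: curve_ring_unit_additive|exact: curve_ring_domain|].
by move=> dp [a pa0]; exact: curve_ring_not_PID pa0.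
Qed.
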